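(* Let $h$ and $t$ be integers with $h\geq 3$ and $t\geq 3$. If $t$ is odd, then $$\{ n\in \mathbb{N}: L(K_n)\in \mathrm{ORTH}[h+1,2,t]\setminus \mathrm{ORTH}[h,2,t]\}=\left[ 2(h-1)^{\frac{t-1}{2}}+1,\ 2h^{\frac{t-1}{2}}\right],$$ and, if $t$ is even, then $$\{ n\in \mathbb{N}: L(K_n)\in \mathrm{ORTH}[h+1,2,t]\setminus \mathrm{ORTH}[h,2,t]\}=\left[ h(h-1)^{\frac{t}{2}-1}+1,\ (h+1)h^{\frac{t}{2}-1}\right].$$
   Context: $L(K_n)$ is the line graph of the complete graph $K_n$. For integers $p,q$, $[p,q]$ denotes the set of integers at least $p$ and at most $q$. For positive integers $h,s,t$, $\mathrm{ORTH}[h,s,t]$ is the class of graphs $G$ having a pair $(T,\mathcal{S})$, where $T$ is a tree of maximum degree at most $h$ and $\mathcal{S}=(S_u)_{u\in V(G)}$ is a collection of subtrees of $T$ of maximum degree at most $s$, one per vertex of $G$, such that every leaf of each $S_u$ is a leaf of $T$, and for all distinct $u,v\in V(G)$ the following are equivalent: (i) $u,v$ adjacent; (ii) $S_u,S_v$ have at least $t$ common vertices; (iii) $S_u,S_v$ share a leaf of $T$. *)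

(* Defs.v *)
From mathcomp Require Import all_boot.

Set Implicit Arguments.
Unset Strict Implicit.
Unset Printing Implicit Defensive.

Record graph := Graph {
  vertex :> finType;
  adj : rel vertex;
  adj_sym : symmetric adj;
  adj_irrefl : irreflexive adj }.

Definition degree (G : graph) (x : G) : nat := #|[set y | adj x y]|.

Definition max_degree_le (G : graph) (k : nat) : Prop :=
  forall x : G, degree x <= k.

(* In the one-vertex tree, the vertex has degree 0 and is not a leaf. *)
Definition leaf (G : graph) (x : G) : bool := degree x == 1.

Definition connected (G : graph) : Prop :=
  0 < #|G| /\ forall x y : G, connect (@adj G) x y.

(* The size condition is needed: for adjacent x and y, [ucycle] also accepts
   [:: x; y]. *)
Definition acyclic (G : graph) : Prop :=
  forall c : seq G, 2 < size c -> ~ ucycle (@adj G) c.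

Definition tree (G : graph) : Prop := connected G /\ acyclic G.

Record subgraph (G : graph) := Subgraph {
  sub_vertices : {set G};
  sub_adj : rel G;
  sub_adj_sym : symmetric sub_adj;
  sub_adj_adj : subrel sub_adj (@adj G);
  sub_adj_vertices : forall x y, sub_adj x y -> x \in sub_vertices }.

Section GraphOfSubgraph.
Variables (G : graph) (H : subgraph G).

Definition subgraph_vertex : finType := {x : G | x \in sub_vertices H}.

Definition subgraph_adj : rel subgraph_vertex :=
  fun x y => sub_adj H (val x) (val y).

Lemma subgraph_adj_sym : symmetric subgraph_adj.
Proof. by move=> x y; apply: sub_adj_sym. Qed.

Lemma subgraph_adj_irrefl : irreflexive subgraph_adj.
Proof.
by move=> x; apply/negP => /(@sub_adj_adj _ H); rewrite adj_irrefl.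
Qed.

Definition graph_of_subgraph : graph :=
  Graph subgraph_adj_sym subgraph_adj_irrefl.

End GraphOfSubgraph.

Definition complete_graph_adj (n : nat) : rel 'I_n := fun x y => x != y.

Lemma complete_graph_adj_sym n : symmetric (@complete_graph_adj n).
Proof. by move=> x y; rewrite /complete_graph_adj eq_sym. Qed.

Lemma complete_graph_adj_irrefl n : irreflexive (@complete_graph_adj n).
Proof. by move=> x; rewrite /complete_graph_adj eqxx. Qed.

Definition complete_graph (n : nat) : graph :=
  Graph (@complete_graph_adj_sym n) (@complete_graph_adj_irrefl n).

Definition edges (G : graph) : {set {set G}} :=
  [set A : {set G} | [exists x, exists y, adj x y && (A == [set x; y])]].

Section LineGraph.
Variable G : graph.

Definition line_graph_vertex : finType := {A : {set G} | A \in edges G}.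

Definition line_graph_adj : rel line_graph_vertex :=
  fun A B => (A != B) && (val A :&: val B != set0).

Lemma line_graph_adj_sym : symmetric line_graph_adj.
Proof. by move=> A B; rewrite /line_graph_adj eq_sym setIC. Qed.

Lemma line_graph_adj_irrefl : irreflexive line_graph_adj.
Proof. by move=> A; rewrite /line_graph_adj eqxx. Qed.

Definition line_graph : graph :=
  Graph line_graph_adj_sym line_graph_adj_irrefl.

End LineGraph.

Definition common_vertices (T : graph) (S1 S2 : subgraph T) : {set T} :=
  sub_vertices S1 :&: sub_vertices S2.

Definition ORTH (h s t : nat) (G : graph) : Prop :=
  exists (T : graph) (S : G -> subgraph T),
    [/\ tree T,
        max_degree_le T h,
        (forall u : G,
           [/\ tree (graph_of_subgraph (S u)),
               max_degree_le (graph_of_subgraph (S u)) s &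
               forall x : graph_of_subgraph (S u), leaf x -> @leaf T (val x)]),
        (forall u v : G, u != v ->
           (adj u v <-> t <= #|common_vertices (S u) (S v)|)) &
        (forall u v : G, u != v ->
           (adj u v <->
            exists2 x : T, leaf x & x \in common_vertices (S u) (S v)))].

(* Main.v *)
Require Import Defs.
From mathcomp Require Import all_boot zify.

(** Both formulas say that [L(K_n)] is in [ORTH[h,2,t]] exactly when [n] is at most the
    number of leaves of the [h]-regular tree of the largest radius allowed by [t],
    centred at an edge if [t] is odd and at a vertex if [t] is even.

    Upper bound. For [n >= 5] every subtree is a path between two leaves of [T], and
    pairwise meeting edges of [K_n] at a common end share a leaf, so that [T] has one leaf
    per vertex of [K_n] and disjoint pairs of these leaves span paths with fewer than [t]
    common vertices. Hence two vertices at which the leaf-spanned tree branches are less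
    than [t - 1] apart, all branching happens within a ball around a central edge or
    vertex, and the leaves are counted level by level.

    Lower bound. Attach a path with [t] further vertices to each leaf of the ball: paths
    with a common end now share [t] vertices, disjoint ones only vertices of the ball. *)

Set Implicit Arguments.
Unset Strict Implicit.
Unset Printing Implicit Defensive.

(** * Sides of the edges of a tree *)

Section Sides.
Variables (T : graph) (treeT : tree T).

(** For adjacent [u] and [v] in a tree, this is the component of [v] after deletion of the edge
    [uv], described by walks that avoid the vertex [u]. *)
Definition side (u v : T) : {set T} :=
  [set x | connect [rel a b : T | [&& adj a b, a != u & b != u]] v x].

Lemma side_refl u v : v \in side u v.
Proof. by rewrite inE connect0. Qed.

Lemma adj_neq (u v : T) : adj u v -> u != v.
Proof. by apply: contraTneq => ->; rewrite adj_irrefl. Qed.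

Lemma side_trans u v x y : x \in side u v -> adj x y -> x != u -> y != u ->
  y \in side u v.
Proof.
rewrite !inE => h xy xu yu; apply: connect_trans h _.
by apply: connect1; rewrite /= xy xu yu.
Qed.

Lemma side_sym u v w : (w \in side u v) = (v \in side u w).
Proof.
rewrite !inE; apply: sym_connect_sym => a b /=.
by rewrite adj_sym [(a != u) && _]andbC.
Qed.

Lemma side_conn u v x y : x \in side u v -> y \in side u x -> y \in side u v.
Proof. by rewrite !inE; apply: connect_trans. Qed.

Lemma path_avoid (u w : T) p :
  path [rel a b : T | [&& adj a b, a != u & b != u]] w p ->
  path (@adj T) w p && (u \notin p).
Proof.
elim: p w => //= x p IH w /andP[/and3P[-> _ xu] /IH /andP[-> up]].
by rewrite inE negb_or eq_sym xu up.
Qed.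

Lemma avoid_path (u w : T) p : path (@adj T) w p -> w != u -> u \notin p ->
  path [rel a b : T | [&& adj a b, a != u & b != u]] w p.
Proof.
elim: p w => //= x p IH w /andP[wx px] wu; rewrite inE negb_or => /andP[ux up].
by rewrite wx wu eq_sym ux /=; apply: IH => //; rewrite eq_sym.
Qed.

Lemma side_notin u v : adj u v -> u \notin side u v.
Proof.
move=> uv; apply/negP; rewrite inE => /connectP[p /path_avoid/andP[_ up] E].
have := mem_last v p; rewrite -E inE (negPf up) orbF => /eqP e.
by move: uv; rewrite e adj_irrefl.
Qed.

(** Otherwise a simple path from [w] to [u] avoiding [v] closes up through [v] to a cycle. *)
Lemma side_nbr u v w : adj v u -> adj v w -> u \in side v w -> u = w.
Proof.
move=> vu vw; rewrite inE => /connectP[p0 /shortenP[p pp up _] E].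
have [pP vp] := andP (path_avoid pp).
case: p => [//|x p] in pp up E pP vp *.
case: treeT => _ /(_ [:: v, w, x & p]) /(_ isT) []; apply/andP; split.
  move: E pP => /= E /andP[wx pxp].
  by rewrite vw wx rcons_path pxp /= adj_sym -E.
by rewrite [uniq _]/= in up; rewrite /= up andbT inE negb_or vp andbT; exact: adj_neq.
Qed.

Lemma side_inj v w1 w2 x : adj v w1 -> adj v w2 ->
  x \in side v w1 -> x \in side v w2 -> w1 = w2.
Proof.
move=> a1 a2 x1; rewrite side_sym => x2.
by apply/esym/(side_nbr a2 a1)/(side_conn x1).
Qed.

(** A walk from [w] avoiding [v] cannot meet [u], by [side_nbr]; preceded by [v], it becomes a walk
    from [v] avoiding [u]. *)
Lemma side_sub u v w : adj u v -> adj v w -> w != u -> side v w \subset side u v.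
Proof.
move=> uv vw wu; apply/subsetP => x; rewrite inE => /connectP[p pp ->].
have vu : adj v u by rewrite adj_sym.
have [pP vp] := andP (path_avoid pp).
have up : u \notin p.
  apply/negP => /splitPr E; case: E pp pP vp => p1 p2 pp pP vp.
  suff /(side_nbr vu vw) e : u \in side v w by move: wu; rewrite e eqxx.
  rewrite inE; apply/connectP; exists (rcons p1 u); last by rewrite last_rcons.
  by move: pp; rewrite -cat_rcons cat_path => /andP[].
have vneu : v != u by rewrite eq_sym adj_neq.
rewrite inE; apply/connectP; exists (w :: p) => //.
by apply: avoid_path => //=; [rewrite vw | rewrite inE negb_or eq_sym wu].
Qed.

Lemma side_step u v x : adj u v -> x \in side u v -> x != v ->
  exists w, [/\ adj v w, w != u & x \in side v w].
Proof.
move=> uv; rewrite inE => /connectP[p0 /shortenP[p pp up _] ->].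
case: p pp up => [|w p] pp up; first by rewrite eqxx.
have /andP[/= /andP[vw pP]] := path_avoid pp.
rewrite inE negb_or eq_sym => /andP[wu _] _; exists w; split=> //.
rewrite inE; apply/connectP; exists p => //.
move: up => /= /andP[]; rewrite inE negb_or eq_sym => /andP[wv vp] _.
exact: avoid_path.
Qed.

Lemma side_cover c x : x != c -> exists2 w, adj c w & x \in side c w.
Proof.
case: treeT => -[_ /(_ c x)] + _ => /connectP[p0 /shortenP[p pp up _] ->].
case: p pp up => [|w p] pp up; first by rewrite eqxx.
move=> _; move: pp => /= /andP[cw pP]; exists w => //.
rewrite inE; apply/connectP; exists p => //.
move: up => /= /andP[]; rewrite inE negb_or eq_sym => /andP[wv vp] _.
exact: avoid_path.
Qed.

(** A point on both sides would lie in two branches at [v], that of [u] and another one. A point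
    outside [side u v] lies in some branch at [v], and all of these except that of [u] are contained
    in [side u v]. *)
Lemma side_setC u v : adj u v -> side v u = ~: side u v.
Proof.
move=> uv; have vu : adj v u by rewrite adj_sym.
apply/setP => x; rewrite in_setC; apply/idP/negP => [xvu xuv|xuv].
  have xv : x != v by apply: contraTneq xvu => ->; exact: side_notin.
  have [w [vw wu xw]] := side_step uv xuv xv.
  by move: wu; rewrite (side_inj vw vu xw xvu) eqxx.
have xv : x != v by apply/eqP => e; apply: xuv; rewrite e side_refl.
have [w vw xw] := side_cover xv.
have [<- //|wu] := eqVneq w u.
by case: xuv; apply: (subsetP (side_sub uv vw wu)).
Qed.

(* Connectedness of the subgraph induced on C, in cut form. *)
Definition linked (C : {set T}) : Prop :=
  forall X : {set T}, C :&: X != set0 -> C :\: X != set0 ->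
  exists x y, [/\ x \in C :&: X, y \in C :\: X & adj x y].

(** The only edge leaving [side u v] is [vu], and a linked set with points on both sides of the cut
    has an edge across it. *)
Lemma linked_cut u v C x y : adj u v -> linked C -> x \in C -> y \in C ->
  x \in side u v -> y \notin side u v -> v \in C.
Proof.
move=> uv linC xC yC xs ys.
have [||a [b []]] := linC (side u v).
- by apply/set0Pn; exists x; rewrite in_setI xC.
- by apply/set0Pn; exists y; rewrite in_setD yC ys.
rewrite in_setI in_setD => /andP[aC a_s] /andP[bs bC] ab.
have au : a != u by apply: contraTneq a_s => ->; exact: side_notin.
have [bu|bu] := eqVneq b u; last by move: bs; rewrite (side_trans a_s ab au bu).
by rewrite -(side_nbr _ uv a_s) // -bu adj_sym.
Qed.

Variable A : {set T}.

(* For leaves A: on some walk from u through v, the subtree spanned by A branches at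
   the (k+1)-st vertex after u or later. *)
Fixpoint wide (k : nat) (u v : T) : bool :=
  if k is k'.+1 then [exists w, [&& adj v w, w != u & wide k' v w]]
  else 1 < #|A :&: side u v|.

(** [P] consists of the [k.+1] vertices of the walk witnessing [wide], and [a], [b] lie in the side
    at its end. A linked set joining [a] or [b] to the outside crosses every edge on the way, so
    [linked_cut] puts all of [P] into it. *)
Lemma wide_fork k u v : adj u v -> wide k u v ->
  exists a b (P : {set T}),
    [/\ [/\ a \in A, b \in A & a != b],
        [/\ a \in side u v, b \in side u v & P \subset side u v],
        k < #|P| &
        forall C y, linked C -> (a \in C) || (b \in C) -> y \in C -> y \notin side u v ->
          P \subset C].
Proof.
elim: k u v => [|k IH] u v uv /=.
  move=> /card_gt1P[a [b [+ + ab]]]; rewrite !in_setI => /andP[aA a_s] /andP[bA bs].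
  exists a, b, [set v]; split=> //; first by rewrite sub1set side_refl.
    by rewrite cards1.
  move=> C y linC /orP[] xC yC ys; rewrite sub1set.
    exact: (linked_cut uv linC xC yC).
  exact: (linked_cut uv linC xC yC).
move=> /existsP[w /and3P[vw wu /(IH _ _ vw)[a [b [P [[aA bA ab] [a_s bs Ps] kP HP]]]]]].
have /subsetP sub := side_sub uv vw wu.
exists a, b, (v |: P); split=> //.
- split; [exact: sub|exact: sub|]; apply/subUsetP; split; first by rewrite sub1set side_refl.
  exact/(subset_trans Ps)/subsetP.
- rewrite cardsU1 (_ : v \notin P) // ; apply/negP => /(subsetP Ps).
  by apply/negP/side_notin.
move=> C y linC abC yC ys; apply/subUsetP; split; last first.
  by apply: (HP _ y) => //; apply: contra ys; exact: sub.
rewrite sub1set; case/orP: abC => xC.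
  exact: (linked_cut uv linC xC yC (sub _ a_s)).
exact: (linked_cut uv linC xC yC (sub _ bs)).
Qed.

Variables (h t : nat).
Hypothesis degT : max_degree_le T h.
Hypothesis leafA : forall a, a \in A -> leaf a.
Hypothesis crossA : forall a b c d, a \in A -> b \in A -> c \in A -> d \in A ->
  a != b -> c != d -> a != c -> a != d -> b != c -> b != d ->
  exists C D, [/\ linked C, linked D, [/\ a \in C, b \in C, c \in D & d \in D] &
    #|C :&: D| < t].

(** The forks [a], [b] beyond [v] and [c], [d] beyond [u] are paired across the edge. The sets
    joining [a] to [c] and [b] to [d] both contain the two disjoint walks, of at least [k.+1] and
    [l.+1] vertices. *)
Lemma wide_opposite k l u v : adj u v -> wide k u v -> wide l v u -> k + l + 2 < t.
Proof.
move=> uv; have vu : adj v u by rewrite adj_sym.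
move=> /(wide_fork uv)[a [b [P [[aA bA ab] [a_s bs Ps] kP HP]]]].
move=> /(wide_fork vu)[c [d [Q [[cA dA cd] [cs ds Qs] lQ HQ]]]].
move: HQ cs ds Qs; rewrite side_setC // => HQ cs ds Qs.
have neq x y : x \in side u v -> y \in ~: side u v -> x != y.
  by move=> xs; apply: contraTneq => <-; rewrite in_setC negbK.
have cb : c != b by rewrite eq_sym neq.
have [C [D [linC linD [aC cC bD dD] lt]]] := crossA aA cA bA dA
  (neq _ _ a_s cs) (neq _ _ bs ds) ab (neq _ _ a_s ds) cb cd.
have sub : P :|: Q \subset C :&: D.
  rewrite subUset !subsetI.
  rewrite (HP C c) ?aC // ?(HP D d) ?bD ?orbT //; last 2 first.
  - by rewrite in_setC in ds.
  - by rewrite in_setC in cs.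
  rewrite (HQ C a) ?cC // ?(HQ D b) ?dD ?orbT //.
  - by rewrite in_setC negbK.
  - by rewrite in_setC negbK.
have PQ : P :&: Q = set0.
  apply/eqP; rewrite setI_eq0 disjoints_subset.
  by apply: subset_trans Ps _; rewrite -[side u v]setCK setCS.
apply: leq_ltn_trans lt; apply: leq_trans (subset_leq_card sub).
by rewrite cardsU PQ cards0 subn0 addn2 -addSn -addnS leq_add.
Qed.

Lemma leaf_nbr (a x y : T) : leaf a -> adj a x -> adj a y -> x = y.
Proof.
move=> /cards1P[z E] ax ay.
have /set1P -> : x \in [set z] by rewrite -E inE.
by have /set1P -> : y \in [set z] by rewrite -E inE.
Qed.

Lemma leaf_side_card u v : adj u v -> v \in A -> #|A :&: side u v| = 1.
Proof.
move=> uv vA; apply/eqP/cards1P; exists v; apply/setP => x.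
rewrite in_setI in_set1; apply/andP/eqP => [[xA xs]|->]; last by rewrite side_refl.
apply/eqP/negPn/negP => xv; have [w [vw wu _]] := side_step uv xs xv.
have vu : adj v u by rewrite adj_sym.
by move: wu; rewrite (leaf_nbr (leafA vA) vu vw) eqxx.
Qed.

Lemma card_sides (N : {set T}) (X : {set T}) v m :
  (forall x, x \in X -> exists2 w, w \in N & x \in A :&: side v w) ->
  (forall w, w \in N -> #|A :&: side v w| <= m) -> #|X| <= #|N| * m.
Proof.
move=> XN Nm.
have sub : X \subset \bigcup_(w in N) (A :&: side v w).
  by apply/subsetP => x /XN[w wN xw]; apply/bigcupP; exists w.
apply: leq_trans (subset_leq_card sub) _; rewrite -sum_nat_const.
apply: (@leq_trans (\sum_(w in N) #|A :&: side v w|)); last exact: leq_sum.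
elim/big_rec2: _ => [|w n Y _ le]; first by rewrite cards0.
by rewrite cardsU; apply: leq_trans (leq_subr _ _) _; rewrite leq_add2l.
Qed.

(** Count by levels: a vertex outside [A] leads on to at most [h - 1] edges, each narrow for
    [k - 1], and a vertex in [A], being a leaf, ends its side. *)
Lemma narrow_card k u v : adj u v -> 1 < h -> ~~ wide k u v ->
  #|A :&: side u v| <= (h - 1) ^ k.
Proof.
move=> + h1; elim: k u v => [|k IH] u v uv /=; first by rewrite -leqNgt expn0.
move=> /existsPn nW.
case: (boolP (v \in A)) => vA; first by rewrite leaf_side_card // expn_gt0; lia.
have vu : adj v u by rewrite adj_sym.
pose N := [set w | adj v w] :\ u.
have cN : #|N| <= h - 1.
  by have := degT v; rewrite /degree (cardsD1 u) inE vu /N; lia.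
rewrite expnS; apply: leq_trans (leq_mul cN (leqnn _)).
apply: (@card_sides N _ v) => [x|w].
  rewrite in_setI => /andP[xA xs].
  have xv : x != v by apply: contraNneq vA => <-.
  have [w [vw wu xw]] := side_step uv xs xv.
  by exists w; [rewrite !inE wu vw | rewrite in_setI xA xw].
rewrite !inE => /andP[wu vw]; apply: IH => //.
by have := nW w; rewrite vw wu.
Qed.

(* A side-minimal wide edge is where the centre of the tree lies. *)
Lemma wide_min k u v : adj u v -> wide k u v ->
  exists u' v', [/\ adj u' v', wide k u' v' &
    forall w, adj v' w -> w != u' -> ~~ wide k v' w].
Proof.
have [m] := ubnP #|side u v|; elim: m u v => // m IH u v + uv W.
have [/existsP[w /and3P[vw wu Ww]] le|/existsPn nW _] :=
  boolP [exists w, [&& adj v w, w != u & wide k v w]].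
  apply: IH Ww => //; rewrite ltnS in le; apply: leq_trans le; apply: proper_card.
  rewrite properEneq side_sub // andbT; apply: contraTneq (side_refl u v) => <-.
  exact: side_notin.
exists u, v; split=> // w vw wu.
by have := nW w; rewrite vw wu.
Qed.

(** An edge narrow in both directions serves as the centre: its two sides partition [A], and
    [narrow_card] bounds each part. *)
Lemma leaf_set_card_odd k : 1 < h -> 0 < k -> t = k.*2.+1 ->
  #|A| <= 2 * (h - 1) ^ k.
Proof.
move=> h1 k0 tk; have [->|/set0Pn[a /leafA /cards1P[b E]]] := eqVneq A set0.
  by rewrite cards0.
have ab : adj a b by have := set11 b; rewrite -E inE.
suff [u [v [uv Wuv Wvu]]] : exists u v, [/\ adj u v, ~~ wide k u v & ~~ wide k v u].
  have vu : adj v u by rewrite adj_sym.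
  have := narrow_card uv h1 Wuv; have := narrow_card vu h1 Wvu.
  rewrite side_setC // -setDE -(cardsID (side u v) A); lia.
(* The edge [v' w] following a side-minimal wide edge [u' v'] is a centre: it is narrow forwards by
   minimality, and backwards because [(k - 1) + k + 2 = t] would contradict [wide_opposite]. *)
have center u v : adj u v -> wide k u v ->
    exists u v, [/\ adj u v, ~~ wide k u v & ~~ wide k v u].
  move=> uv /(wide_min uv)[u' [v' [uv' + nW]]]; rewrite -[k](prednK k0).
  move=> /existsP[w /and3P[vw wu W]]; exists v', w; rewrite prednK //.
  split=> //; first exact: nW.
  by apply/negP => /(wide_opposite vw W); rewrite tk; lia.
have ba : adj b a by rewrite adj_sym.
have [/(center _ _ ab) //|nab] := boolP (wide k a b).
have [/(center _ _ ba) //|nba] := boolP (wide k b a).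
by exists a, b.
Qed.

(** Here the centre is a vertex [c] all of whose outgoing edges are narrow, so that at most [h]
    sides contribute [(h - 1) ^ k] each. *)
Lemma leaf_set_card_even k : 1 < h -> 0 < k -> t = k.*2.+2 ->
  #|A| <= h * (h - 1) ^ k.
Proof.
move=> h1 k0 tk; have [->|/set0Pn[a /leafA /cards1P[b E]]] := eqVneq A set0.
  by rewrite cards0.
have ab : adj a b by have := set11 b; rewrite -E inE.
have ba : adj b a by rewrite adj_sym.
suff [c nc] : exists c, forall w, adj c w -> ~~ wide k c w.
  (* If the centre itself is a leaf in [A], it counts for one and its only branch for at most
     [(h - 1) ^ k]. *)
  case: (boolP (c \in A)) => cA.
    have /cards1P[d Ed] := leafA cA.
    have cd : adj c d by have := set11 d; rewrite -Ed inE.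
    have dc : adj d c by rewrite adj_sym.
    have := narrow_card cd h1 (nc _ cd); have := leaf_side_card dc cA.
    rewrite side_setC // -setDE -(cardsID (side c d) A).
    have : 0 < (h - 1) ^ k by rewrite expn_gt0; lia.
    nia.
  apply: leq_trans (leq_mul (degT c) (leqnn _)); rewrite /degree.
  apply: (@card_sides _ _ c) => [x xA|w].
    have xc : x != c by apply: contraNneq cA => <-.
    have [w cw xw] := side_cover xc.
    by exists w; [rewrite inE | rewrite in_setI xA].
  by rewrite inE => cw; apply: narrow_card => //; exact: nc.
have [|] := boolP [exists u, exists v, adj u v && wide k u v]; last first.
  move=> /existsPn nW; exists a => w aw; apply/negP => W.
  by have /existsPn/(_ w) := nW a; rewrite aw W.
move=> /existsP[u0 /existsP[v0 /andP[uv0 /(wide_min uv0)[u [v [uv W nW]]]]]].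
move: W; rewrite -{1}[k](prednK k0) => /existsP[w /and3P[vw wu W]].
(* The end [v] of a side-minimal wide edge is a centre: minimality handles all neighbours but [u],
   and if [vu] were wide, [wv] would be wide for [k.+1], against [(k + 1) + (k - 1) + 2 = t]. *)
exists v => x vx; have [->|/(nW x vx) //] := eqVneq x u.
have vu : adj v u by rewrite adj_sym.
have wv : adj w v by rewrite adj_sym.
apply/negP => Wvu; have : wide k.+1 w v.
  by apply/existsP; exists u; rewrite vu eq_sym wu.
move=> W'; have := wide_opposite wv W' W; rewrite tk -addnn.
by case: (k) k0 => //= m _; rewrite !addSn !addnS addn0 !ltnS ltnn.
Qed.

End Sides.

(** * Leaves of subtrees and the points of a line system *)

(** The simple path between two leaves is closed under adjacency, since its inner vertices already
    have two neighbours on it and its ends one. By connectedness a third leaf would be an inner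
    vertex, of degree two. *)
Lemma leaf_card_le2 (G : graph) : connected G -> max_degree_le G 2 ->
  #|[set x : G | leaf x]| <= 2.
Proof.
move=> [_ conG] degG; rewrite leqNgt; apply/negP => /card_gt2P[x [y [z]]].
rewrite !inE => -[[lx ly lz] [xy yz zx]].
have two (u a b : G) : adj u a -> adj u b -> a != b -> 1 < degree u.
  by move=> ua ub ab; apply/card_gt1P; exists a, b; rewrite !inE.
have leaf2 (u a b : G) : leaf u -> adj u a -> adj u b -> a = b.
  move=> /eqP lu ua ub; apply/eqP/negPn/negP => /(two _ _ _ ua ub).
  by rewrite lu.
have /connectP[p0 /shortenP[p pp up _] yE] := conG x y.
have adjS i : i < size p -> adj (nth x (x :: p) i) (nth x (x :: p) i.+1).
  by move=> ip; apply: (pathP x pp).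
have adjP i : 0 < i -> i <= size p -> adj (nth x (x :: p) i) (nth x (x :: p) i.-1).
  by case: i => // i _ ip; rewrite adj_sym adjS.
have nthneq i : 0 < i -> i < size p -> nth x (x :: p) i.-1 != nth x (x :: p) i.+1.
  case: i => // i _ ip; rewrite nth_uniq //= ?ltnS; last exact: ltnW (ltnW ip).
  by rewrite neq_ltn leqnSn.
have p0' : 0 < size p.
  by case: (p) yE => //= e; move: xy; rewrite e eqxx.
have lastE : y = nth x (x :: p) (size p) by rewrite yE (last_nth x).
have clo : closed (@adj G) [in x :: p].
  apply: (intro_closed (sym_connect_sym (@adj_sym G))) => u v uv us.
  have [i ip uE] : exists2 i, i <= size p & u = nth x (x :: p) i.
    exists (index u (x :: p)); rewrite ?nth_index //.
    by rewrite -ltnS -[X in _ < X]/(size (x :: p)) index_mem.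
  apply: contraT => vs.
  have neq j : j <= size p -> nth x (x :: p) j != v.
    by move=> jp; apply: contraNneq vs => <-; apply: mem_nth.
  have [i0|i0] := posnP i.
    have := adjS _ p0'; rewrite i0 in uE; rewrite /= in uE; rewrite -uE => ua.
    rewrite uE in uv ua.
    have e := leaf2 _ _ _ lx uv ua.
    by have := neq 1 p0'; rewrite e /= eqxx.
  have [i1|i1] := eqVneq i (size p).
    have uy : u = y by rewrite uE i1.
    have := adjP _ i0 ip; rewrite -uE => ua; rewrite uy in uv ua.
    have := neq i.-1 (leq_trans (leq_pred i) ip).
    by rewrite (leaf2 _ _ _ ly ua uv) eqxx.
  have ip' : i < size p by rewrite ltn_neqAle i1.
  have := degG u; rewrite leqNgt => /negP[]; apply/card_gt2P.
  exists (nth x (x :: p) i.-1), (nth x (x :: p) i.+1), v; rewrite !inE.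
  rewrite uv {1 2}uE adjS // adjP // nthneq // neq // eq_sym neq //.
  exact: leq_trans (leq_pred i) ip.
have zs : z \in x :: p.
  have := closed_connect clo (conG x z); rewrite unfold_in /= mem_head => <- //.
have [i ip zE] : exists2 i, i <= size p & z = nth x (x :: p) i.
  exists (index z (x :: p)); rewrite ?nth_index //.
  by rewrite -ltnS -[X in _ < X]/(size (x :: p)) index_mem.
have i0 : 0 < i by case: (i) zE => // e; move: zx; rewrite e eqxx.
have ip' : i < size p.
  rewrite ltn_neqAle ip andbT; apply: contra_neq yz => e.
  by rewrite zE e lastE.
rewrite zE in lz; have /eqP := nthneq i i0 ip'; case.
exact: leaf2 lz (adjP _ i0 ip) (adjS _ ip').
Qed.

Section SubgraphLeaves.
Variables (T : graph) (H : subgraph T).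
Hypothesis conH : connected (graph_of_subgraph H).

Lemma subgraph_linked : linked (sub_vertices H).
Proof.
move=> X /set0Pn[x]; rewrite inE => /andP[xH xX] /set0Pn[y].
rewrite inE => /andP[yX yH].
have [/existsP[a /existsP[b /and3P[]]]|/existsPn nX] :=
  boolP [exists a, exists b, [&& a \in sub_vertices H :&: X,
         b \in sub_vertices H :\: X & adj a b]]; first by exists a, b.
have clo : closed (@subgraph_adj T H) [pred z | val z \in X].
  apply: (intro_closed (sym_connect_sym (@subgraph_adj_sym T H))) => u v uv us.
  apply: contraT => vX; have /existsPn/(_ (val v)) := nX (val u).
  rewrite !inE (valP u) (valP v) (sub_adj_adj uv) andbT /=.
  by move: us vX; rewrite !inE => -> ->.
have := closed_connect clo (conH.2 (Sub x xH) (Sub y yH)).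
by rewrite !inE /= xX (negPf yX).
Qed.

Lemma subgraph_degree (x : graph_of_subgraph H) : degree x <= degree (val x).
Proof.
rewrite /degree -(card_imset _ val_inj); apply/subset_leq_card/subsetP => y.
by case/imsetP => z; rewrite !inE => xz ->; exact: (sub_adj_adj xz).
Qed.

(** Converse of the leaf condition in [ORTH]: the degree in [H] is at most that in [T], and a second
    vertex makes it positive by connectedness. *)
Lemma subgraph_leaf (x : graph_of_subgraph H) :
  1 < #|sub_vertices H| -> leaf (val x) -> leaf x.
Proof.
move=> H1 /eqP lx; rewrite /leaf eqn_leq -{1}lx subgraph_degree /= card_gt0.
have [y yH yx] : exists2 y, y \in sub_vertices H & y != val x.
  have /card_gt1P[a [b [aH bH ab]]] := H1.
  have [e|] := eqVneq a (val x); last by exists a.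
  by exists b => //; rewrite -e eq_sym.
have /connectP[[|z p] /= ] := conH.2 x (Sub y yH).
  by move=> _ e; move: yx; rewrite -e eqxx.
by move=> /andP[xz _] _; apply/set0Pn; exists z; rewrite inE.
Qed.

Lemma subgraph_tree_leaves : max_degree_le (graph_of_subgraph H) 2 ->
  1 < #|sub_vertices H| -> #|[set x in sub_vertices H | leaf x]| <= 2.
Proof.
move=> degH H1; apply: leq_trans (leaf_card_le2 conH degH).
rewrite -(card_imset _ val_inj); apply/subset_leq_card/subsetP => x.
rewrite inE => /andP[xH lx]; apply/imsetP; exists (Sub x xH : graph_of_subgraph H) => //.
by rewrite inE; apply: subgraph_leaf.
Qed.

End SubgraphLeaves.

Lemma exists_notin (I : finType) (s : seq I) : size s < #|I| -> exists x, x \notin s.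
Proof.
move=> lt; apply/existsP; rewrite -negb_forall; apply/negP => /forallP all_s.
have sub : I \subset s by apply/subsetP => x _; exact: all_s.
move: lt; rewrite ltnNge => /negP[].
exact: leq_trans (subset_leq_card sub) (card_size s).
Qed.

Lemma eq_set2 (X : finType) (B : {set X}) x y :
  #|B| <= 2 -> x \in B -> y \in B -> x != y -> B = [set x; y].
Proof.
move=> B2 xB yB xy; apply/esym/eqP; rewrite eqEcard cards2 xy B2 andbT.
by apply/subsetP => z /set2P[] ->.
Qed.

(* Whitney's root-graph argument for complete graphs: four pairwise meeting,
   distinct sets of size at most two have a common point. *)
Lemma line_system_points (I X : finType) (F : I -> I -> {set X}) :
  4 < #|I| -> (forall a b, F a b = F b a) ->
  (forall a b, a != b -> #|F a b| <= 2) ->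
  (forall a b c, a != b -> a != c -> b != c -> F a b :&: F a c != set0) ->
  (forall a b c d, a != b -> c != d -> a != c -> a != d -> b != c -> b != d ->
     F a b :&: F c d = set0) ->
  exists2 l : I -> X, injective l & forall a b, a != b -> l a \in F a b.
Proof.
move=> I5 symF F2 meetF disF.
have disj x a b c d : a != b -> c != d -> a != c -> a != d -> b != c -> b != d ->
    x \in F a b -> x \in F c d -> False.
  move=> ab cd ac ad bc bd xab xcd; have := disF a b c d ab cd ac ad bc bd.
  by move/setP/(_ x); rewrite !inE xab xcd.
have meet a b c : a != b -> a != c -> b != c -> exists2 x, x \in F a b & x \in F a c.
  by move=> ab ac bc; have /set0Pn[x /setIP[]] := meetF a b c ab ac bc; exists x.
have fresh s : size s < 5 -> exists x : I, x \notin s.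
  by move=> ss; apply: exists_notin; apply: leq_trans I5.
(* [F b d] meets [F b a]; if this were [F a c], the disjoint pairs [b d] and [a c] would have
   meeting sets. *)
have distF a b c : a != b -> a != c -> b != c -> F a b <> F a c.
  move=> ab ac bc e; have [//|d] := fresh [:: a; b; c].
  rewrite !inE !negb_or => /and3P[da db dc].
  have [ba ad bd cb cd] : [/\ b != a, a != d, b != d, c != b & c != d].
    by rewrite eq_sym ab eq_sym da eq_sym db eq_sym bc eq_sym dc.
  have [x xba xbd] := meet b a d ba bd ad.
  by apply: (disj x a c b d) => //; rewrite -e symF.
have point a : exists x, forall b, a != b -> x \in F a b.
  have [//|b] := fresh [:: a]; rewrite inE => ba.
  have [//|c] := fresh [:: a; b]; rewrite !inE negb_or => /andP[ca cb].
  rewrite eq_sym in ba; rewrite eq_sym in ca; rewrite eq_sym in cb.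
  have [x xb xc] := meet a b c ba ca cb; exists x => d ad.
  have [<- //|bd] := eqVneq b d; have [<- //|cd] := eqVneq c d.
  (* If [x] missed [F a d], the three sets at [a] would form a triangle [xy], [xz], [yz]. The fifth
     index [e] gives a fourth set that meets all three, hence contains two corners and equals one of
     the sides. *)
  apply: contraT => xd.
  have [y yb yd] := meet a b d ba ad bd.
  have [z zc zd] := meet a c d ca ad cd.
  have xy : x != y by apply: contraNneq xd => ->.
  have xz : x != z by apply: contraNneq xd => ->.
  have Eb := eq_set2 (F2 _ _ ba) xb yb xy.
  have Ec := eq_set2 (F2 _ _ ca) xc zc xz.
  have yz : y != z.
    by apply/eqP => e; apply: (distF a b c) => //; rewrite Eb Ec e.
  have Ed := eq_set2 (F2 _ _ ad) yd zd yz.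
  have [//|e] := fresh [:: a; b; c; d].
  rewrite !inE !negb_or => /and4P[ea eb ec ed].
  rewrite eq_sym in ea.
  have Db := distF a e b ea ba eb; have Dc := distF a e c ea ca ec.
  have Dd := distF a e d ea ad ed.
  have pair := eq_set2 (F2 _ _ ea).
  have [w we] := meet a e b ea ba eb; rewrite Eb => /set2P[] E; rewrite {w}E in we.
    have [w we'] := meet a e d ea ad ed; rewrite Ed => /set2P[] E; rewrite {w}E in we'.
      by case: Db; rewrite Eb; apply: pair.
    by case: Dc; rewrite Ec; apply: pair.
  have [w we'] := meet a e c ea ca ec; rewrite Ec => /set2P[] E; rewrite {w}E in we'.
    by case: Db; rewrite Eb; apply: pair.
  by case: Dd; rewrite Ed; apply: pair.
have [l lP] := fin_all_exists point; exists l => // a b lab.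
apply/eqP; apply: contraT => ab.
have [//|c] := fresh [:: a; b]; rewrite !inE negb_or => /andP[ca cb].
have [//|d] := fresh [:: a; b; c]; rewrite !inE !negb_or => /and3P[da db dc].
have [ac bd ad cd] : [/\ a != c, b != d, a != d & c != d].
  by rewrite eq_sym ca eq_sym db eq_sym da eq_sym dc.
by case: (disj (l a) a c b d) => //; rewrite ?lP // lab lP.
Qed.

(** * The upper bound *)

Lemma mem_edges_complete n (a b : 'I_n) :
  a != b -> [set a; b] \in edges (complete_graph n).
Proof.
move=> ab; rewrite inE; apply/existsP; exists a; apply/existsP; exists b.
by rewrite eqxx andbT.
Qed.

Definition kedge n (a b : 'I_n) (ab : a != b) : line_graph (complete_graph n) :=
  Sub [set a; b] (mem_edges_complete ab).

Lemma kedgeP n (u : line_graph (complete_graph n)) :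
  exists a b (ab : a != b), u = kedge ab.
Proof.
have := valP u; rewrite inE => /existsP[a /existsP[b /andP[ab /eqP E]]].
by exists a, b, ab; apply: val_inj.
Qed.

Lemma kedge_adj n (a b c : 'I_n) (ab : a != b) (ac : a != c) :
  b != c -> adj (kedge ab) (kedge ac).
Proof.
move=> bc; apply/andP; split; last first.
  by apply/set0Pn; exists a; rewrite /= !inE eqxx.
apply/eqP => /(congr1 val) /setP /(_ b) /=.
by rewrite !inE eqxx orbT eq_sym (negPf ab) (negPf bc).
Qed.

Lemma kedge_nadj n (a b c d : 'I_n) (ab : a != b) (cd : c != d) :
  a != c -> a != d -> b != c -> b != d ->
  kedge ab != kedge cd /\ ~~ adj (kedge ab) (kedge cd).
Proof.
move=> ac ad bc bd; split.
  apply/eqP => /(congr1 val) /setP /(_ a) /=.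
  by rewrite !inE eqxx (negPf ac) (negPf ad).
rewrite negb_and negbK orbC; apply/orP; left; rewrite negbK.
apply/eqP/setP => x; rewrite /= !inE; apply/negP => /andP[].
by move=> /orP[] /eqP-> /orP[] /eqP e; move: ac ad bc bd; rewrite e eqxx.
Qed.

(** [A] consists of the points that [line_system_points] finds for the family of leaves of [T] in
    each subtree. Disjoint edges of [K_n] are not adjacent in the line graph, so their subtrees
    serve as the sets with fewer than [t] common vertices. *)
Lemma ORTH_leaf_set h t n : 2 < t -> 4 < n ->
  ORTH h 2 t (line_graph (complete_graph n)) ->
  exists (T : graph) (A : {set T}),
    [/\ tree T, max_degree_le T h, forall a, a \in A -> leaf a, #|A| = n &
      forall a b c d, a \in A -> b \in A -> c \in A -> d \in A ->
        a != b -> c != d -> a != c -> a != d -> b != c -> b != d ->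
        exists C D, [/\ linked C, linked D,
          [/\ a \in C, b \in C, c \in D & d \in D] & #|C :&: D| < t]].
Proof.
move=> t2 n4 [T [S [treeT degT treeS adjt adjl]]]; exists T.
pose L u := [set x in sub_vertices (S u) | leaf x].
pose F (a b : 'I_n) := if insub [set a; b] is Some u then L u else set0.
have FE a b (ab : a != b) : F a b = L (kedge ab).
  rewrite /F; case: insubP => [u _ uE|/negP[]]; last exact: mem_edges_complete.
  by congr L; apply: val_inj.
have symF a b : F a b = F b a by rewrite /F setUC.
have fresh (s : seq 'I_n) : size s < 5 -> exists x, x \notin s.
  by move=> ss; apply: exists_notin; rewrite card_ord; apply: leq_trans n4.
have neq_adj u v : @adj (line_graph (complete_graph n)) u v -> u != v.
  by case/andP.
(* An adjacent edge shares [t] vertices with this one, so no subtree is a single vertex and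
   [subgraph_tree_leaves] applies. *)
have big a b (ab : a != b) : 1 < #|sub_vertices (S (kedge ab))|.
  have [//|c] := fresh [:: a; b]; rewrite !inE negb_or eq_sym => /andP[ac cb].
  rewrite eq_sym in cb; have ad := kedge_adj ab ac cb.
  have := (adjt _ _ (neq_adj _ _ ad)).1 ad => le.
  apply: leq_trans (ltnW t2) (leq_trans le _).
  exact/subset_leq_card/subsetIl.
have [||a b ab|a b c ab ac bc|a b c d ab cd ac ad bc bd|l injl lF] :=
    @line_system_points 'I_n T F.
- by rewrite card_ord.
- exact: symF.
- rewrite FE; have [[conS _] degS _] := treeS (kedge ab).
  exact: subgraph_tree_leaves.
- rewrite !FE; have ad := kedge_adj ab ac bc.
  have [x lx xC] := (adjl _ _ (neq_adj _ _ ad)).1 ad.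
  by apply/set0Pn; exists x; move: xC; rewrite !inE lx !andbT.
- rewrite !FE; have [ne /negP nad] := kedge_nadj ab cd ac ad bc bd.
  apply/setP => x; rewrite inE in_set0; apply/negP => /andP[].
  rewrite !inE => /andP[xu lx] /andP[xv _].
  by apply: nad; apply/(adjl _ _ ne); exists x => //; rewrite inE xu.
exists (l @: 'I_n); split=> //.
- move=> x /imsetP[a _ ->]; have [//|b] := fresh [:: a].
  by rewrite inE eq_sym => ab; have := lF _ _ ab; rewrite FE inE => /andP[].
- by rewrite card_imset // card_ord.
move=> ? ? ? ? /imsetP[a _ ->] /imsetP[b _ ->] /imsetP[c _ ->] /imsetP[d _ ->].
rewrite !(inj_eq injl) => ab cd ac ad bc bd.
have [ne nad] := kedge_nadj ab cd ac ad bc bd.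
exists (sub_vertices (S (kedge ab))), (sub_vertices (S (kedge cd))).
have inl x y (xy : x != y) : l x \in sub_vertices (S (kedge xy)).
  by have := lF _ _ xy; rewrite FE inE => /andP[].
have inr x y (xy : x != y) : l y \in sub_vertices (S (kedge xy)).
  have yx : y != x by rewrite eq_sym.
  by have := lF _ _ yx; rewrite symF FE inE => /andP[].
split.
- by apply: subgraph_linked; have [[]] := treeS (kedge ab).
- by apply: subgraph_linked; have [[]] := treeS (kedge cd).
- by split; rewrite ?inl ?inr.
by rewrite ltnNge; apply: contra nad => le; apply/(adjt _ _ ne).
Qed.

Lemma pred_exp_gt1 h k : 2 < h -> 0 < k -> 1 < (h - 1) ^ k.
Proof. by move=> h2 k0; rewrite -{1}(exp1n k) ltn_exp2r // ltn_subRL. Qed.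

Lemma ORTH_bound_odd h k n : 2 < h -> 0 < k ->
  ORTH h 2 k.*2.+1 (line_graph (complete_graph n)) -> n <= 2 * (h - 1) ^ k.
Proof.
(* For [n <= 4] the bound holds outright, since [(h - 1) ^ k] is at least two; larger [n] provides
   the five indices that the root-graph argument uses. *)
move=> h2 k0 O; have [n4|n4] := leqP n 4.
  by apply: leq_trans n4 _; rewrite (@leq_mul 2 2) ?pred_exp_gt1.
have t2 : 2 < k.*2.+1 by case: (k) k0.
have [T [A [treeT degT leafA <- cross]]] := ORTH_leaf_set t2 n4 O.
exact: (leaf_set_card_odd treeT degT leafA cross (ltnW h2) k0).
Qed.

Lemma ORTH_bound_even h k n : 2 < h -> 0 < k ->
  ORTH h 2 k.*2.+2 (line_graph (complete_graph n)) -> n <= h * (h - 1) ^ k.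
Proof.
move=> h2 k0 O; have [n4|n4] := leqP n 4.
  by apply: leq_trans n4 _; rewrite (@leq_mul 2 2) ?pred_exp_gt1 // ltnW.
have t2 : 2 < k.*2.+2 by case: (k) k0.
have [T [A [treeT degT leafA <- cross]]] := ORTH_leaf_set t2 n4 O.
exact: (leaf_set_card_even treeT degT leafA cross (ltnW h2) k0).
Qed.

(** * Paths in a tree of nested classes *)

Lemma subgraph_acyclic (T : graph) (H : subgraph T) :
  acyclic T -> acyclic (graph_of_subgraph H).
Proof.
move=> acT c c2 /andP[cyc uc]; apply: (acT (map val c)); first by rewrite size_map.
rewrite /ucycle map_inj_uniq ?uc ?andbT; last exact: val_inj.
by apply: homo_cycle cyc => x y; exact: sub_adj_adj.
Qed.

(** * Simple paths as subgraphs *)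

Section PathSubgraph.
Variables (T : graph) (acT : acyclic T) (x0 : T) (s : seq T).
Hypotheses (us : uniq s) (ss : sorted (@adj T) s) (s0 : 0 < size s).

Definition path_adj : rel T := fun u v =>
  [&& u \in s, v \in s & (index u s == (index v s).+1) || (index v s == (index u s).+1)].

Lemma path_adj_sym : symmetric path_adj.
Proof. by move=> u v; rewrite /path_adj andbCA orbC. Qed.

Lemma path_adj_nth i : i.+1 < size s -> path_adj (nth x0 s i) (nth x0 s i.+1).
Proof.
move=> lt; have lt' := ltnW lt.
by rewrite /path_adj !mem_nth //= !index_uniq // eqxx orbT.
Qed.

Lemma path_adj_adj : subrel path_adj (@adj T).
Proof.
move=> u v /and3P[uS vS /orP[] /eqP E].
  rewrite adj_sym -(nth_index u uS) -(nth_index u vS) E.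
  by apply: (sortedP u ss); rewrite -E index_mem.
rewrite -(nth_index u uS) -(nth_index u vS) E.
by apply: (sortedP u ss); rewrite -E index_mem.
Qed.

Lemma path_adj_vertices u v : path_adj u v -> u \in [set x in s].
Proof. by rewrite inE => /and3P[]. Qed.

Definition path_subgraph : subgraph T :=
  Subgraph path_adj_sym path_adj_adj path_adj_vertices.

Lemma path_subgraph_tree : tree (graph_of_subgraph path_subgraph).
Proof.
split; last exact: subgraph_acyclic.
have nthS i : i < size s -> nth x0 s i \in sub_vertices path_subgraph.
  by move=> lt; rewrite inE mem_nth.
pose r : graph_of_subgraph path_subgraph := Sub (nth x0 s 0) (nthS _ s0).
have cr i (lt : i < size s) :
    connect (@subgraph_adj T path_subgraph) r (Sub (nth x0 s i) (nthS _ lt)).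
  elim: i lt => [|i IH] lt; first by apply: eq_connect0; apply: val_inj.
  apply: connect_trans (IH (ltnW lt)) _; apply: connect1.
  exact: path_adj_nth.
have cr' x : connect (@subgraph_adj T path_subgraph) r x.
  have xs : val x \in s by have := valP x; rewrite inE.
  have lt : index (val x) s < size s by rewrite index_mem.
  have := cr _ lt; congr connect; apply: val_inj => /=.
  by rewrite nth_index.
split; first by apply/card_gt0P; exists r.
move=> x y; apply: connect_trans (cr' y).
by rewrite (sym_connect_sym (@subgraph_adj_sym _ _)).
Qed.

Lemma path_subgraph_degree : max_degree_le (graph_of_subgraph path_subgraph) 2.
Proof.
move=> x; rewrite /degree -(card_imset _ val_inj).
set i := index (val x) s.
(* At an end of [s] one of these entries is spurious, namely the vertex itself or the default [x0],
   which does no harm to an upper bound. *)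
apply: leq_trans (_ : #|[set nth x0 s i.-1; nth x0 s i.+1]| <= 2); last first.
  by rewrite cards2; case: (_ != _).
apply/subset_leq_card/subsetP => y /imsetP[z]; rewrite inE => /and3P[_ zs E] ->.
rewrite !inE; apply/orP; case/orP: E => /eqP E; [left|right].
  by rewrite /i E /= nth_index.
by rewrite /i -E nth_index.
Qed.

Lemma path_subgraph_leaf (x : graph_of_subgraph path_subgraph) : degree x <= 1 ->
  val x = nth x0 s 0 \/ val x = nth x0 s (size s).-1.
Proof.
have xs : val x \in s by have := valP x; rewrite inE.
have lt : index (val x) s < size s by rewrite index_mem.
move=> dx; set i := index (val x) s in lt.
have E : val x = nth x0 s i by rewrite nth_index.
have [i0|i0] := posnP i; first by left; rewrite E i0.
have [i1|i1] := eqVneq i (size s).-1; first by right; rewrite E i1.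
have lt1 : i.+1 < size s.
  by rewrite -(prednK s0) ltnS ltn_neqAle i1 -ltnS (prednK s0).
have lt0 : i.-1 < size s := leq_ltn_trans (leq_pred i) lt.
have nS j : j < size s -> nth x0 s j \in sub_vertices path_subgraph.
  by move=> lj; rewrite inE mem_nth.
move: dx; rewrite leqNgt => /negP[]; apply/card_gt1P.
pose y : graph_of_subgraph path_subgraph := Sub (nth x0 s i.-1) (nS _ lt0).
pose z : graph_of_subgraph path_subgraph := Sub (nth x0 s i.+1) (nS _ lt1).
exists y, z; rewrite !inE; split.
- rewrite /subgraph_adj /= path_adj_sym E.
  by have := @path_adj_nth i.-1; rewrite prednK //; apply.
- by rewrite /subgraph_adj /= E; apply: path_adj_nth.
by rewrite -(inj_eq val_inj) /= nth_uniq // neq_ltn prednK // leqnSn.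
Qed.

End PathSubgraph.

Lemma sorted_rev_cat (X : Type) (e : rel X) (x : X) u v : symmetric e ->
  path e x u -> path e x v -> sorted e (rev u ++ x :: v).
Proof.
move=> symE; elim: u x v => //= y u IH x v /andP[xy yu] xv.
by rewrite rev_cons cat_rcons; apply: IH; rewrite //= symE xy.
Qed.

(* A nested sequence of equivalence relations on I (the fibres of [f j], finer
   as j grows) is turned into a tree: its vertices are the classes, a class is
   joined to the classes of the next level it contains, and the at most two
   classes of level 0 are joined to each other. *)
Section LaminarTree.
Variables (I X : finType) (f : nat -> I -> X) (D : nat).
Hypothesis f_refine : forall j a b, f j.+1 a = f j.+1 b -> f j a = f j b.
Hypothesis f_top : forall a b c, [\/ f 0 a = f 0 b, f 0 b = f 0 c | f 0 a = f 0 c].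
Hypothesis D0 : 0 < D.

(** Storing the level keeps equal classes of different levels apart; the singletons repeated on the
    deep levels become the long paths to the leaves. *)
Definition class : finType := {p : 'I_D.+1 * X | [exists a, f p.1 a == p.2]}.

Lemma class_proof (j : 'I_D.+1) a : [exists b, f j b == f j a].
Proof. by apply/existsP; exists a. Qed.

Definition cls (j : nat) (a : I) : class :=
  Sub (inord j, f (inord j : 'I_D.+1) a) (class_proof (inord j) a).

Lemma cls_surj (v : class) : exists j a, j <= D /\ v = cls j a.
Proof.
case: v => -[j x] /= P; have /existsP[a /eqP /= E] := P; exists j, a.
split; first by rewrite -ltnS.
by apply: val_inj; rewrite /= inord_val E.
Qed.

Lemma cls_eq i j a b : i <= D -> j <= D -> (cls i a == cls j b) = (i == j) && (f i a == f j b).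
Proof.
by move=> iD jD; rewrite -val_eqE /= xpair_eqE -val_eqE /= !inordK.
Qed.

Lemma f_le i j a b : i <= j -> f j a = f j b -> f i a = f i b.
Proof. by move=> /subnK <-; elim: (j - i) => // m IH /f_refine. Qed.

Definition child : rel class := fun p q =>
  [exists j : 'I_D, exists a, (p == cls j a) && (q == cls j.+1 a)].

Definition tops : rel class := fun p q =>
  [&& p != q, [exists a, p == cls 0 a] & [exists a, q == cls 0 a]].

Definition laminar_adj : rel class := fun p q => [|| child p q, child q p | tops p q].

Lemma laminar_adj_sym : symmetric laminar_adj.
Proof.
move=> p q; apply/or3P/or3P => -[pq|pq|/and3P[ne pP qP]].
- exact: Or32.
- exact: Or31.
- by apply/Or33/and3P; rewrite eq_sym.
- exact: Or32.
- exact: Or31.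
- by apply/Or33/and3P; rewrite eq_sym.
Qed.

Lemma childP p q :
  reflect (exists j a, [/\ j < D, p = cls j a & q = cls j.+1 a]) (child p q).
Proof.
apply: (iffP existsP) => [[j /existsP[a /andP[/eqP-> /eqP->]]]|[j [a [jD -> ->]]]].
  by exists j, a.
by exists (Ordinal jD); apply/existsP; exists a; rewrite /= !eqxx.
Qed.

Lemma laminar_adj_irrefl : irreflexive laminar_adj.
Proof.
move=> p; rewrite /laminar_adj /tops eqxx orbF orbb; apply/childP => -[j [a [jD -> /eqP]]].
by rewrite cls_eq ?(ltnW jD) // eqn_leq ltnn andbF.
Qed.

Definition laminar_tree : graph := Graph laminar_adj_sym laminar_adj_irrefl.

Lemma adj_cls (j : nat) a : j < D -> @adj laminar_tree (cls j a) (cls j.+1 a).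
Proof. by move=> jD; apply/or3P/Or31/childP; exists j, a. Qed.

Lemma adj_top a b : cls 0 a != cls 0 b -> @adj laminar_tree (cls 0 a) (cls 0 b).
Proof.
by move=> ne; apply/or3P/Or33/and3P; split=> //; apply/existsP; [exists a|exists b].
Qed.

Lemma cls_nbr j a (q : laminar_tree) : j <= D -> adj (cls j a : laminar_tree) q ->
  [\/ exists2 b, j < D /\ f j b = f j a & q = cls j.+1 b,
      0 < j /\ q = cls j.-1 a
    | j = 0 /\ exists2 b, cls 0 a != cls 0 b & q = cls 0 b].
Proof.
move=> jD /or3P[/childP[i [b [iD /eqP + ->]]]|/childP[i [b [iD -> /eqP]]]|].
- rewrite cls_eq // ?(ltnW iD) // => /andP[/eqP ji /eqP E].
  by subst i; constructor 1; exists b.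
- rewrite cls_eq // => /andP[/eqP ji /eqP E]; subst j; constructor 2; split=> //=.
  by apply/eqP; rewrite cls_eq ?(ltnW iD) // eqxx; apply/eqP/f_refine.
move=> /and3P[ne /existsP[c /eqP E] /existsP[b /eqP qE]]; constructor 3.
move/eqP: E; rewrite cls_eq // => /andP[/eqP j0 _]; split=> //.
by exists b => //; rewrite -qE -j0.
Qed.

Lemma cls_connect a j b i : j <= D -> i <= D ->
  connect (@adj laminar_tree) (cls j a) (cls i b).
Proof.
have to0 c k : k <= D -> connect (@adj laminar_tree) (cls 0 c) (cls k c).
  elim: k => // k IH kD; apply: connect_trans (IH (ltnW kD)) _.
  exact/connect1/adj_cls.
move=> jD iD; apply: connect_trans (to0 b i iD).
apply: (@connect_trans _ _ (cls 0 a)).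
  by rewrite (sym_connect_sym (@adj_sym laminar_tree)) to0.
have [->|ne] := eqVneq (cls 0 a) (cls 0 b); first exact: connect0.
exact/connect1/adj_top.
Qed.

Definition level (v : class) : nat := (val v).1.

Lemma level_cls j a : j <= D -> level (cls j a) = j.
Proof. by move=> jD; rewrite /level /= inordK. Qed.

(** Take a vertex of maximal level on a cycle. Its two cycle neighbours lie no deeper, so at
    positive level both are its parent, and at level 0 they are two top classes besides its own,
    against [f_top]. *)
Lemma laminar_acyclic : acyclic laminar_tree.
Proof.
move=> c c2 /andP[cyc uc].
have [v0 v0c] : exists v, v \in c by case: (c) c2 => // v; exists v; rewrite mem_head.
have [v vc vmax] : exists2 v, v \in c & forall w, w \in c -> level w <= level v.
  by case: (arg_maxnP level v0c) => v vc vmax; exists v.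
have [i s E] := rot_to vc.
have mem_s w : w \in v :: s -> level w <= level v.
  by rewrite -E mem_rot; apply: vmax.
move: cyc uc c2; rewrite -(rot_cycle i) -(rot_uniq i) -(size_rot i) E.
case: s mem_s {E} => // x s; case/lastP: s => // s y mem_s.
rewrite /= rcons_path last_rcons !inE !mem_rcons !inE !negb_or.
move=> /and3P[vx _ yv] /and3P[/and3P[v_x v_y _] /andP[x_y _] _] _.
have vy : adj v y by rewrite adj_sym.
have lx : level x <= level v by apply: mem_s; rewrite !inE eqxx orbT.
have ly : level y <= level v by apply: mem_s; rewrite !inE mem_rcons !inE eqxx !orbT.
have [j [a [jD vE]]] := cls_surj v; move: vx vy lx ly; rewrite {}vE level_cls //.
move=> vx vy.
case: (cls_nbr jD vx) => [[b [jD' _] ->]|[j0 xE]|[j0 [b ab xE]]].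
- by rewrite level_cls // ltnn.
- case: (cls_nbr jD vy) => [[b [jD' _] ->]|[_ yE]|[j1]].
  + by rewrite [level (cls _ b)]level_cls // ltnn.
  + by move: x_y; rewrite xE yE eqxx.
  by rewrite j1 in j0.
case: (cls_nbr jD vy) => [[c' [jD' _] ->]|[j1]|[_ [c' ac yE]]].
- by rewrite [level (cls _ c')]level_cls // ltnn.
- by rewrite j0 in j1.
move: x_y ab ac; rewrite xE yE !cls_eq //= => /eqP bc /eqP ab /eqP ac.
by case: (f_top a b c').
Qed.

Lemma laminar_tree_tree (a : I) : tree laminar_tree.
Proof.
split; last exact: laminar_acyclic.
split; first by apply/card_gt0P; exists (cls 0 a).
move=> v w; have [j [b [jD ->]]] := cls_surj v; have [i [c [iD ->]]] := cls_surj w.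
exact: cls_connect.
Qed.

Definition kids j a : {set X} := [set f j.+1 b | b in [pred b | f j b == f j a]].

Lemma kids_card j a : j < D ->
  #|[set cls j.+1 b | b in [pred b | f j b == f j a]]| <= #|kids j a|.
Proof.
move=> jD; rewrite -(@card_in_imset _ _ (fun v : class => (val v).2)).
  apply/subset_leq_card/subsetP => x /imsetP[v /imsetP[b fb ->] ->].
  by apply/imsetP; exists b => //=; rewrite inordK.
move=> v w /imsetP[b _ ->] /imsetP[c _ ->] /= /eqP E; apply/eqP.
by rewrite cls_eq // eqxx /=; move: E; rewrite inordK.
Qed.

Lemma top_card : #|[set cls 0 b | b : I]| <= #|[set f 0 b | b : I]|.
Proof.
rewrite -(@card_in_imset _ _ (fun v : class => (val v).2)).
  apply/subset_leq_card/subsetP => x /imsetP[v /imsetP[b fb ->] ->].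
  by apply/imsetP; exists b => //=; rewrite inordK.
move=> v w /imsetP[b _ ->] /imsetP[c _ ->] /= /eqP E; apply/eqP.
by rewrite cls_eq //=; move: E; rewrite inordK.
Qed.

(** A class of level 0 sees its children and the other top classes, one fewer than all of them,
    whence the bound [h.+1]. Between levels 0 and [D] there is one parent besides the children, and
    at level [D] only a parent. *)
Lemma laminar_degree h : 0 < h ->
  (forall a, #|[set f 0 b | b : I]| + #|kids 0 a| <= h.+1) ->
  (forall j a, 0 < j < D -> #|kids j a| < h) -> max_degree_le laminar_tree h.
Proof.
move=> h0 deg0 degS v; have [j [a [jD ->]]] := cls_surj v; rewrite /degree.
case: j jD => [|j] jD.
  have sub : [set q | @adj laminar_tree (cls 0 a) q] \subset
      ([set cls 0 b | b : I] :\ cls 0 a) :|: [set cls 1 b | b in [pred b | f 0 b == f 0 a]].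
    apply/subsetP => q; rewrite inE => /(cls_nbr jD)[[b [_ fb] ->]|[]//|[_ [b ne ->]]].
      by rewrite inE; apply/orP; right; apply/imsetP; exists b; rewrite ?inE ?fb.
    by rewrite !inE eq_sym ne; apply/orP; left; apply/imsetP; exists b.
  apply: leq_trans (subset_leq_card sub) _; rewrite cardsU.
  apply: leq_trans (leq_subr _ _) _; rewrite -ltnS; apply: leq_trans (deg0 a).
  rewrite -addSn leq_add ?kids_card //; apply: leq_trans top_card.
  by rewrite [X in _ <= X](cardsD1 (cls 0 a)) imset_f.
have [jD'|jD'] := ltnP j.+1 D; last first.
  have sub : [set q | @adj laminar_tree (cls j.+1 a) q] \subset [set cls j a].
    apply/subsetP => q; rewrite inE => /(cls_nbr jD)[[b [lt _] _]|[_ ->]|[]//].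
      by move: lt; rewrite ltnNge jD'.
    by rewrite inE.
  by apply: leq_trans (subset_leq_card sub) _; rewrite cards1.
have sub : [set q | @adj laminar_tree (cls j.+1 a) q] \subset
    cls j a |: [set cls j.+2 b | b in [pred b | f j.+1 b == f j.+1 a]].
  apply/subsetP => q; rewrite inE => /(cls_nbr jD)[[b [_ fb] ->]|[_ ->]|[]//].
    by rewrite inE; apply/orP; right; apply/imsetP; exists b; rewrite ?inE ?fb.
  by rewrite !inE eqxx.
apply: leq_trans (subset_leq_card sub) _; rewrite cardsU1.
apply: leq_trans (degS j.+1 a jD'); rewrite -[X in _ <= X]add1n.
by apply: leq_add; [case: (_ \notin _)|exact: kids_card].
Qed.

Lemma leaf_cls a : @leaf laminar_tree (cls D a).
Proof.
apply/cards1P; exists (cls D.-1 a); apply/setP => q; rewrite !inE.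
apply/idP/eqP => [/(cls_nbr (leqnn D))[[b [] ]|[_ ->]|[D0' _]]|->] //.
- by rewrite ltnn.
- by move: D0; rewrite D0'.
by rewrite adj_sym -{2}(prednK D0) adj_cls // prednK.
Qed.

Variable K : nat.
Hypothesis KD : K <= D.
Hypothesis f_inj : forall j, K <= j -> injective (f j).

Lemma cls_path l m a : l + m <= D ->
  path (@adj laminar_tree) (cls l a) [seq cls j a | j <- iota l.+1 m].
Proof.
elim: m l => //= m IH l; rewrite -addSnnS => lD; rewrite IH // andbT.
by apply: adj_cls; apply: leq_trans (leq_addr _ _) lD.
Qed.

(** The path climbs from [cls D a] to just above the level [l] where [a] and [b] separate, then
    descends to [cls D b]. As [l <= K], it contains all classes of [a] and [b] from level [K] on. *)
Lemma laminar_path a b : a != b ->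
  exists H : subgraph laminar_tree,
    [/\ tree (graph_of_subgraph H), max_degree_le (graph_of_subgraph H) 2,
        forall x : graph_of_subgraph H, degree x <= 1 ->
          val x = cls D a \/ val x = cls D b,
        forall y, y \in sub_vertices H ->
          exists x, x \in [set a; b] /\ exists2 j, j <= D & y = cls j x &
        forall x j, x \in [set a; b] -> K <= j <= D -> cls j x \in sub_vertices H].
Proof.
move=> ab.
have exl : exists l, f l a != f l b.
  by exists K; apply: contra_neq ab => /(f_inj (leqnn K)).
case: (ex_minnP exl) => l ne lmin.
have lK : l <= K by apply: lmin; apply: contra_neq ab => /(f_inj (leqnn K)).
have lD := leq_trans lK KD.
(* For [l > 0], level [m] holds the last common class of [a] and [b]. For [l = 0], [m] is 0 as well,
   and the path crosses the edge between the two top classes. *)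
pose m := l.-1; have mD : m <= D := leq_trans (leq_pred l) lD.
pose u := [seq cls j a | j <- iota m.+1 (D - m)].
pose v := [seq cls j b | j <- iota l (D.+1 - l)].
pose s := rev u ++ cls m a :: v.
have neq i j : l <= i -> i <= D -> j <= D -> cls i a != cls j b.
  move=> li iD jD; rewrite cls_eq //; apply/negP => /andP[/eqP <- /eqP E].
  by move: ne; rewrite (f_le li E) eqxx.
have ss : sorted (@adj laminar_tree) s.
  apply: sorted_rev_cat; first exact: adj_sym.
    by apply: cls_path; rewrite subnKC.
  rewrite /v subSn //= cls_path ?subnKC // andbT.
  have [l0|l0] := posnP l; first by rewrite /m l0; apply: adj_top; apply: neq; rewrite ?l0.
  have mE : l = m.+1 by rewrite prednK.
  have -> : cls m a = cls m b.
    apply/eqP; rewrite cls_eq // eqxx; apply: contraT => /lmin.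
    by rewrite mE ltnn.
  by rewrite mE; apply: adj_cls; rewrite -mE.
have inj_cls c i n : i + n <= D.+1 -> uniq [seq cls j c | j <- iota i n].
  move=> inD; rewrite map_inj_in_uniq ?iota_uniq // => j k.
  rewrite !mem_iota => /andP[_ jn] /andP[_ kn] /eqP.
  by rewrite cls_eq -1?ltnS ?(leq_trans jn) ?(leq_trans kn) // => /andP[/eqP].
have us : uniq s.
  rewrite /s cat_uniq rev_uniq inj_cls ?addSn ?subnKC //= inj_cls ?subnKC ?(leqW lD) //.
  rewrite andbT; apply/andP; split.
    rewrite mem_rev; apply/norP; split.
      apply/mapP => -[j]; rewrite mem_iota addSn subnKC // ltnS => /andP[mj jD] /eqP.
      by rewrite cls_eq // => /andP[/eqP e _]; move: mj; rewrite e ltnn.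
    apply/hasPn => y /mapP[j]; rewrite mem_iota subnKC ?(leqW lD) // ltnS => /andP[lj jD] ->.
    rewrite mem_rev; apply/mapP => -[i].
    rewrite mem_iota addSn subnKC // ltnS => /andP[mi iD] /esym /eqP; apply/negP/neq => //.
    by apply: leq_trans mi; rewrite /m; case: (l).
  apply/mapP => -[j]; rewrite mem_iota subnKC ?(leqW lD) // ltnS => /andP[lj jD] /eqP.
  rewrite cls_eq // => /andP[/eqP e /eqP E].
  have l0 : l = 0 by move: lj; rewrite -e /m; case: (l) => //= k; rewrite ltnn.
  by move: ne; rewrite l0; move: E; rewrite -e /m l0 /= => ->; rewrite eqxx.
have s0 : 0 < size s by rewrite /s size_cat addnS.
pose x0 : laminar_tree := cls D a.
have mem_s y : y \in s -> exists x, x \in [set a; b] /\ exists2 j, j <= D & y = cls j x.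
  rewrite mem_cat mem_rev inE => /or3P[/mapP[j]|/eqP ->|/mapP[j]].
  - rewrite mem_iota addSn subnKC // ltnS => /andP[_ jD] ->.
    by exists a; rewrite set21; split=> //; exists j.
  - by exists a; rewrite set21; split=> //; exists m.
  rewrite mem_iota subnKC ?(leqW lD) // ltnS => /andP[_ jD] ->.
  by exists b; rewrite set22; split=> //; exists j.
have mD' : m < D by rewrite /m; case: (l) lD.
have head_s : nth x0 s 0 = cls D a.
  rewrite nth_cat size_rev size_map size_iota subn_gt0 mD'.
  rewrite nth_rev ?size_map ?size_iota ?subn_gt0 //.
  have lt : D - m - 1 < D - m by rewrite subn1 prednK ?subn_gt0.
  rewrite (nth_map 0) ?size_iota // nth_iota // addSnnS subn1 prednK ?subn_gt0 //.
  by rewrite subnKC.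
have last_s : nth x0 s (size s).-1 = cls D b.
  rewrite nth_last last_cat /= -nth_last size_map size_iota subSn //=.
  have lt : D - l < D.+1 - l by rewrite subSn.
  by rewrite (nth_map 0) ?size_iota // nth_iota // subnKC.
exists (path_subgraph ss); split.
- exact: (path_subgraph_tree laminar_acyclic x0).
- exact: (path_subgraph_degree x0).
- by move=> x /(path_subgraph_leaf x0 us s0); rewrite head_s last_s.
- by move=> y; rewrite inE; apply: mem_s.
move=> x j /set2P[] -> /andP[Kj jD]; rewrite inE mem_cat mem_rev inE; apply/or3P.
  have [->|jm] := eqVneq j m; first by constructor 2.
  constructor 1; apply: map_f; rewrite mem_iota addSn subnKC // ltnS jD andbT.
  rewrite ltn_neqAle eq_sym jm; apply: leq_trans (leq_pred l) (leq_trans lK Kj).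
constructor 3; apply: map_f; rewrite mem_iota subnKC ?(leqW lD) // ltnS jD andbT.
exact: leq_trans Kj.
Qed.

End LaminarTree.

(** * The lower bound *)

(** From level [K] on a class determines its label, so levels [K] to [K + t] form a private path for
    each label. Edges with a common end thus share at least [t] classes, while disjoint ones share
    only classes of levels below [K], fewer than [t] by the last hypothesis. *)
Lemma ORTH_of_laminar n (X : finType) (f : nat -> 'I_n -> X) (K t h : nat) :
  0 < n -> 0 < t -> 0 < h ->
  (forall j a b, f j.+1 a = f j.+1 b -> f j a = f j b) ->
  (forall a b c, [\/ f 0 a = f 0 b, f 0 b = f 0 c | f 0 a = f 0 c]) ->
  (forall j, K <= j -> injective (f j)) ->
  (forall a, #|[set f 0 b | b : 'I_n]| + #|kids f 0 a| <= h.+1) ->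
  (forall j a, 0 < j -> #|kids f j a| < h) ->
  (forall u : {set 'I_n}, #|u| <= 2 ->
     #|[set cls f (K + t) p.1 p.2 | p : 'I_K * 'I_n in setX setT u]| < t) ->
  ORTH h 2 t (line_graph (complete_graph n)).
Proof.
move=> n0 t0 h0 f_refine f_top f_inj deg0 degS few.
pose D := K + t; have D0 : 0 < D by rewrite addn_gt0 t0 orbT.
have KD : K <= D by rewrite leq_addr.
have treeT := laminar_tree_tree D f_refine f_top (Ordinal n0).
have injD : injective (f D) by apply: f_inj.
have /fin_all_exists[S SP] (u : line_graph (complete_graph n)) :
    exists H : subgraph (laminar_tree f D),
    [/\ tree (graph_of_subgraph H), max_degree_le (graph_of_subgraph H) 2,
        forall x : graph_of_subgraph H, degree x <= 1 ->
          exists2 a, a \in val u & val x = cls f D D a,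
        forall y, y \in sub_vertices H ->
          exists a, a \in val u /\ exists2 j, j <= D & y = cls f D j a &
        forall a j, a \in val u -> K <= j <= D -> cls f D j a \in sub_vertices H].
  have [a [b [ab ->]]] := kedgeP u.
  have [H [H1 H2 H3 H4 H5]] := laminar_path f_refine f_top D0 KD f_inj ab.
  exists H; split=> // x /H3[] ->; [exists a|exists b] => //=.
    exact: set21.
  exact: set22.
exists (laminar_tree f D), S.
have leafS u (x : graph_of_subgraph (S u)) : degree x <= 1 ->
  exists2 a, a \in val u & val x = cls f D D a by have [_ _ + _ _] := SP u; apply.
have memS (u : line_graph (complete_graph n)) a j :
    a \in val u -> K <= j <= D -> cls f D j a \in sub_vertices (S u).
  by have [_ _ _ _] := SP u; apply.
have adjE (u v : line_graph (complete_graph n)) : u != v -> adj u v ->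
    exists2 a, a \in val u & a \in val v.
  by move=> _ /andP[_ /set0Pn[a /setIP[au av]]]; exists a.
split=> //.
- by apply: laminar_degree => // j a /andP[j0 _]; apply: degS.
- move=> u; have [H1 H2 H3 _ _] := SP u; split=> // x /eqP lx.
  by have [|a _ ->] := H3 x; [rewrite lx | exact: leaf_cls].
- move=> u v uv; split=> [/(adjE _ _ uv)[a au av]|].
    have sub : [set cls f D (K + j) a | j : 'I_t] \subset common_vertices (S u) (S v).
      apply/subsetP => _ /imsetP[j _ ->].
      have jD : K <= K + j <= D by rewrite leq_addr leq_add2l ltnW.
      by rewrite inE !memS.
    apply: leq_trans (subset_leq_card sub); rewrite card_imset ?card_ord // => i j /eqP.
    rewrite cls_eq ?leq_add2l ?(ltnW (ltn_ord _)) // eqn_add2l => /andP[/eqP ij _].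
    exact: val_inj.
  apply: contraTT => nadj; rewrite -ltnNge.
  have u2 : #|val u| <= 2.
    by have [a [b [ab ->]]] := kedgeP u; rewrite /= cards2 ab.
  apply: leq_ltn_trans (few _ u2); apply/subset_leq_card/subsetP => y.
  rewrite inE => /andP[yu yv].
  have [_ _ _ /(_ y yu)[a [au [j jD yE]]] _] := SP u.
  have [_ _ _ /(_ y yv)[b [bv [i iD yE']]] _] := SP v.
  move/eqP: yE'; rewrite yE; rewrite cls_eq // => /andP[/eqP ji /eqP E].
  rewrite -ji in E; have [jK|Kj] := ltnP j K.
    by apply/imsetP; exists (Ordinal jK, a) => //; rewrite !inE.
  case/negP: nadj; rewrite /= /line_graph_adj uv; apply/set0Pn; exists a.
  by rewrite inE au (f_inj _ Kj _ _ E).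
move=> u v uv; split=> [/(adjE _ _ uv)[a au av]|[y ly]].
  exists (cls f D D a); first exact: leaf_cls.
  by rewrite inE !memS // leqnn KD.
rewrite inE => /andP[yu yv].
have deg1 w (yw : y \in sub_vertices (S w)) : exists2 a, a \in val w & y = cls f D D a.
  apply: (leafS w (Sub y yw : graph_of_subgraph (S w))).
  by rewrite (leq_trans (subgraph_degree _)) // (eqP ly).
have [a au yE] := deg1 u yu; have [b bv /eqP] := deg1 v yv.
rewrite yE; rewrite cls_eq // eqxx => /eqP/injD E.
rewrite /= /line_graph_adj uv; apply/set0Pn; exists a.
by rewrite inE au E.
Qed.

(** Covers [n = 0], where [laminar_tree] has no vertices and hence is not a tree. *)
Lemma ORTH_empty h s t (G : graph) : #|G| = 0 -> ORTH h s t G.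
Proof.
move=> G0; have noG (u : G) : False by have := fintype0 u G0.
exists (complete_graph 1), (fun u => False_rect _ (noG u)).
split; try by move=> u; case: (noG u).
- split; last first.
    move=> c c2 /andP[_ /card_uniqP cE].
    by have := max_card [in c]; rewrite cE card_ord leqNgt ltnW.
  split; first by rewrite card_ord.
  by move=> x y; rewrite !ord1.
move=> x; rewrite /degree (_ : [set y | _] = set0) ?cards0 //.
by apply/setP => y; rewrite !inE /= /complete_graph_adj !ord1 eqxx.
Qed.

(** * Nested classes from digit expansions *)

Section DigitClasses.
Variables (n w K : nat) (e : bool).
Hypothesis w0 : 0 < w.

Definition digit_class_val (j : nat) (a : nat) : nat :=
  if e && (j == 0) then 0 else a %/ w ^ (K - j).

Lemma digit_class_val_lt j (a : 'I_n) : digit_class_val j a < n.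
Proof.
apply: leq_ltn_trans (ltn_ord a); rewrite /digit_class_val.
by case: ifP => // _; apply: leq_div.
Qed.

(* The labels 0, ..., n-1 are read as words of base-w digits; the j-th class of
   a label is its prefix obtained by dropping the last K - j digits. When [e]
   holds, the leading digit is dropped as well at level 0. *)
Definition digit_class j (a : 'I_n) : 'I_n := Ordinal (digit_class_val_lt j a).

Lemma digit_class_refine j a b :
  digit_class j.+1 a = digit_class j.+1 b -> digit_class j a = digit_class j b.
Proof.
move/(congr1 val); rewrite /= /digit_class_val andbF => E; apply: val_inj => /=.
rewrite /digit_class_val; case: ifP => // _; have [jK|Kj] := ltnP j K.
  by rewrite -subSS subSn // expnS mulnC !divnMA E.
by move: E; rewrite (eqP (leqW Kj : K - j.+1 == 0)) (eqP (Kj : K - j == 0)).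
Qed.

Lemma digit_class_inj j : 0 < K -> K <= j -> injective (digit_class j).
Proof.
move=> K0 Kj a b /(congr1 val); rewrite /= /digit_class_val.
rewrite (gtn_eqF (leq_trans K0 Kj)) andbF (eqP (Kj : K - j == 0)) !divn1.
exact: val_inj.
Qed.

(** Prefixes extending a given prefix differ only in their last digit, read off modulo [w]. With
    [e], level 0 is a single class whose children are counted separately. *)
Lemma digit_class_kids j a : e ==> (0 < j) -> #|kids digit_class j a| <= w.
Proof.
move=> ej; have je : e && (j == 0) = false.
  by move: ej; case: e => //=; rewrite lt0n => /negPf.
pose g (x : 'I_n) : 'I_w := Ordinal (ltn_pmod x w0).
rewrite -[X in _ <= X]card_ord -(@card_in_imset _ _ g); first exact: max_card.
move=> x y /imsetP[b]; rewrite inE => /eqP Eb -> /imsetP[c]; rewrite inE => /eqP Ec ->.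
move/(congr1 val) => /= Em; apply: val_inj => /=.
have := congr1 val (etrans Eb (esym Ec)); move: Em.
rewrite /= /digit_class_val andbF je; have [jK|Kj] := ltnP j K.
  rewrite -[K - j]subSS subSn // expnS mulnC !divnMA => Em Ed.
  by rewrite (divn_eq (b %/ _) w) Ed Em -divn_eq.
by rewrite (eqP (leqW Kj : K - j.+1 == 0)) (eqP (Kj : K - j == 0)).
Qed.

End DigitClasses.

Lemma card_ord_set_lt n m (S : {set 'I_n}) : (forall x, x \in S -> x < m) -> #|S| <= m.
Proof.
move=> Sm; case: m => [|m] in Sm *.
  by rewrite leqn0 cards_eq0 -subset0; apply/subsetP => x /Sm.
rewrite -[X in _ <= X]card_ord -(@card_in_imset _ _ (fun x : 'I_n => inord x : 'I_m.+1)).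
  exact: max_card.
move=> x y /Sm xm /Sm ym /(congr1 val) /=; rewrite !inordK //; exact: val_inj.
Qed.

Lemma card_line_graph_complete_lt1 n : n < 1 -> #|line_graph (complete_graph n)| = 0.
Proof.
rewrite ltnS leqn0 => /eqP ->; apply: eq_card0 => u.
by have [[]] := kedgeP u.
Qed.

(** With base [h - 1] and [K = k], the bound on [n] leaves at most two prefixes at level 0, the ends
    of the central edge. Two labels have at most [2 * k] classes on the levels below [k]. *)
Lemma ORTH_line_odd h k n : 1 < h -> 0 < k -> n <= 2 * (h - 1) ^ k ->
  ORTH h 2 k.*2.+1 (line_graph (complete_graph n)).
Proof.
move=> h1 k0 nb; have [n0|n0] := ltnP n 1.
  exact/ORTH_empty/card_line_graph_complete_lt1.
have w0 : 0 < h - 1 by rewrite subn_gt0.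
have top_lt (a : 'I_n) : digit_class (h - 1) k false 0 a < 2.
  rewrite /= /digit_class_val subn0 ltn_divLR ?expn_gt0 ?w0 //.
  exact: leq_trans (ltn_ord a) nb.
apply: (@ORTH_of_laminar n _ (digit_class (h - 1) k false) k) => //.
- exact: ltnW.
- exact: digit_class_refine.
- move=> a b c; have := top_lt a; have := top_lt b; have := top_lt c.
  move: (digit_class _ _ _ 0 a) (digit_class _ _ _ 0 b) (digit_class _ _ _ 0 c) => x y z.
  have [xy|xy] := eqVneq x y; first by constructor 1.
  have [yz|yz] := eqVneq y z; first by constructor 2.
  move=> z2 y2 x2; constructor 3; apply: val_inj.
  by move: xy yz; rewrite -!val_eqE /=; lia.
- by move=> j; apply: digit_class_inj.
- have hE : h.+1 = 2 + (h - 1) by clear -h1; lia.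
  move=> a; rewrite hE leq_add ?digit_class_kids //.
  by apply: card_ord_set_lt => x /imsetP[b _ ->].
- move=> j a _; apply: leq_ltn_trans (digit_class_kids _ w0 _ _) _ => //.
  by rewrite ltn_subrL (ltnW h1).
move=> u u2; rewrite ltnS; apply: leq_trans (leq_imset_card _ _) _.
by rewrite cardsX cardsT card_ord -muln2 leq_mul2l u2 orbT.
Qed.

(** Level 0 is now the single central class, added above [k] further levels; the bound on [n] leaves
    at most [h] leading digits for its children. *)
Lemma ORTH_line_even h k n : 1 < h -> 0 < k -> n <= h * (h - 1) ^ k ->
  ORTH h 2 k.*2.+2 (line_graph (complete_graph n)).
Proof.
move=> h1 k0 nb; have [n0|n0] := ltnP n 1.
  exact/ORTH_empty/card_line_graph_complete_lt1.
have w0 : 0 < h - 1 by rewrite subn_gt0.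
pose f := @digit_class n (h - 1) k.+1 true.
have top a b : f 0 a = f 0 b by apply: val_inj.
apply: (@ORTH_of_laminar n _ f k.+1) => //.
- exact: ltnW.
- exact: digit_class_refine.
- by move=> a b c; constructor 1.
- by move=> j; apply: digit_class_inj.
- move=> a; rewrite -add1n leq_add //.
    by apply: card_ord_set_lt => x /imsetP[b _ ->].
  apply: card_ord_set_lt => x /imsetP[b _ ->].
  rewrite /= /digit_class_val /= subSS subn0 ltn_divLR ?expn_gt0 ?w0 //.
  exact: leq_trans (ltn_ord b) nb.
- move=> j a j0; apply: leq_ltn_trans (digit_class_kids _ w0 _ _) _ => //.
  by rewrite ltn_subrL (ltnW h1).
move=> u u2; set c := cls f (k.+1 + k.*2.+2).
(* Level 0 contributes one class and each of the other [k] levels at most two, in all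
   [2 * k + 1 < t]. *)
have sub : [set c p.1 p.2 | p : 'I_k.+1 * 'I_n in setX setT u] \subset
    c 0 (Ordinal n0) |: [set c p.1.+1 p.2 | p : 'I_k * 'I_n in setX setT u].
  apply/subsetP => y /imsetP[[[[|j] jk] a]]; rewrite !inE /= => au ->.
    by apply/orP; left; rewrite cls_eq //=.
  by apply/orP; right; apply/imsetP; exists (Ordinal (jk : j < k), a); rewrite ?inE.
apply: leq_ltn_trans (subset_leq_card sub) _; rewrite cardsU1 ltnS -[X in _ <= X]add1n.
apply: leq_add; first by case: (_ \notin _).
apply: leq_trans (leq_imset_card _ _) _.
by rewrite cardsX cardsT card_ord -muln2 leq_mul2l u2 orbT.
Qed.

(** * Exact thresholds and the resulting intervals *)

Lemma ORTH_line_oddE h k n : 2 < h -> 0 < k ->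
  ORTH h 2 k.*2.+1 (line_graph (complete_graph n)) <-> n <= 2 * (h - 1) ^ k.
Proof.
by move=> h2 k0; split; [exact: ORTH_bound_odd | exact: ORTH_line_odd (ltnW h2) k0].
Qed.

Lemma ORTH_line_evenE h k n : 2 < h -> 0 < k ->
  ORTH h 2 k.*2.+2 (line_graph (complete_graph n)) <-> n <= h * (h - 1) ^ k.
Proof.
by move=> h2 k0; split; [exact: ORTH_bound_even | exact: ORTH_line_even (ltnW h2) k0].
Qed.

Theorem theorem3 (h t : nat) (hh : 3 <= h) (ht : 3 <= t) :
  (odd t -> forall n : nat,
     (ORTH (h + 1) 2 t (line_graph (complete_graph n)) /\
      ~ ORTH h 2 t (line_graph (complete_graph n))) <->
     2 * (h - 1) ^ ((t - 1) %/ 2) + 1 <= n <= 2 * h ^ ((t - 1) %/ 2)) /\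
  (~~ odd t -> forall n : nat,
     (ORTH (h + 1) 2 t (line_graph (complete_graph n)) /\
      ~ ORTH h 2 t (line_graph (complete_graph n))) <->
     h * (h - 1) ^ (t %/ 2 - 1) + 1 <= n <= (h + 1) * h ^ (t %/ 2 - 1)).
Proof.
have h1 : 2 < h + 1 by rewrite addn1 ltnW.
split=> [todd n|teven n].
  have [k tE k0] : exists2 k, t = k.*2.+1 & 0 < k.
    by exists t./2; [rewrite -[LHS]odd_double_half todd | move: ht; clear; lia].
  have -> : (t - 1) %/ 2 = k by rewrite tE subn1 divn2 doubleK.
  (* Membership at [h + 1] and at [h] becomes an upper bound on [n], and the difference of the two
     is an interval. *)
  rewrite tE !ORTH_line_oddE // addnK addn1.
  by split=> [[-> /negP]|/andP[lt ->]];
    rewrite ?andbT -?ltnNge //; split=> //; apply/negP; rewrite -ltnNge.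
have [k tE k0] : exists2 k, t = k.*2.+2 & 0 < k.
  exists (t./2).-1; last by move: ht teven; clear; lia.
  by move: ht teven; clear; lia.
have -> : t %/ 2 - 1 = k by rewrite tE divn2 -doubleS doubleK subn1.
rewrite tE !ORTH_line_evenE // addnK [_ * _ + 1]addn1.
by split=> [[-> /negP]|/andP[lt ->]];
    rewrite ?andbT -?ltnNge //; split=> //; apply/negP; rewrite -ltnNge.
Qed.
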